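(* Let $\beta>0$ and let $k\ge 1$ be an integer. Then the limit below exists and $$\lim_{N \to \infty} \frac{1}{N} \log \mathbb{E} \big[ Z_N(\beta)^k \big] = \max_{(p_{\sigma})} \Big\{ - \sum_{\sigma \in \{-1, 1\}^k} p_{\sigma} \log p_{\sigma} + \frac{\beta^2}{4} \sum_{\sigma, \sigma' \in\{-1, 1\}^k} p_{\sigma} p_{\sigma'} (\sigma \cdot \sigma')^2 \Big\},$$ where the maximum is taken over all families of $2^k$ non-negative real numbers $p_\sigma$ indexed by $\sigma \in \{-1, 1\}^k$ such that $\sum_{\sigma\in\{-1,1\}^k} p_{\sigma} = 1$.
   Context: For an integer $N\ge 2$ and $\beta>0$, the partition function of the Sherrington-Kirkpatrick model is the random variable $$Z_N(\beta) := \sum_{\sigma \in \{-1, 1\}^N} \exp \Big\{ \frac{\beta}{\sqrt{N}} \sum_{1 \leq i < j \leq N} g_{i j} \sigma_i \sigma_j \Big\},$$ where $g_{ij}$, $1\le i<j\le N$, are independent standard normal random variables, and $\mathbb{E}$ denotes expectation over the $g_{ij}$. Here $\sigma\cdot\sigma'=\sum_{i=1}^k\sigma_i\sigma'_i$ is the scalar product, $\log$ is the natural logarithm, and $0\log 0:=0$. *)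

(* Defs.v *)
From HB Require Import structures.
From mathcomp Require Export all_boot all_order all_algebra.
From mathcomp Require Export all_classical all_reals all_analysis.
Export Order.TTheory GRing.Theory Num.Theory.
Export numFieldNormedType.Exports.

Set Implicit Arguments.
Unset Strict Implicit.
Unset Printing Implicit Defensive.

Local Open Scope classical_set_scope.
Local Open Scope ring_scope.

(* A configuration sigma in {-1,1}^n is encoded by a finite function with
   boolean values; [spin] gives the actual value in {-1,1}. *)
Definition spin (R : realType) (b : bool) : R := if b then 1 else -1.

Definition config (n : nat) := {ffun 'I_n -> bool}.

Definition config_dot (R : realType) (n : nat) (s t : config n) : R :=
  \sum_(i < n) spin R (s i) * spin R (t i).

Definition simplex (R : realType) (I : finType) : set (I -> R) :=
  [set p | (forall i, 0 <= p i) /\ \sum_i p i = 1].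
Arguments simplex R I : clear implicits.

(* The convention 0 log 0 = 0 is automatic, since [0 * ln 0 = 0]. *)
Definition entropy_energy (R : realType) (k : nat) (beta : R)
    (p : config k -> R) : R :=
  - (\sum_(s : config k) p s * ln (p s))
  + beta ^+ 2 / 4 * \sum_(s : config k) \sum_(t : config k)
      p s * p t * config_dot R s t ^+ 2.

Definition is_maximum (R : realType) (A : set R) (m : R) : Prop :=
  A m /\ ubound A m.

Section Probability.
Context (d : measure_display) (T : measurableType d) (R : realType)
        (P : probability T R).

(* Mutual independence of the subfamily of [X] indexed by [D]. *)
Definition mutually_independent (I : finType) (D : {set I})
    (X : I -> {RV P >-> R}) : Prop :=
  forall (J : {set I}) (A : I -> set R), J \subset D ->
    (forall i, i \in J -> measurable (A i)) ->
    P (\bigcap_(i in [set` J]) (X i @^-1` A i))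
    = (\prod_(i in J) P (X i @^-1` A i))%E.

Definition standard_normal (X : {RV P >-> R}) : Prop :=
  forall A : set R, measurable A -> distribution P X A = normal_prob 0 1 A.

Definition upper_pairs (N : nat) : {set 'I_N * 'I_N} :=
  [set ij : 'I_N * 'I_N | (ij.1 < ij.2)%N]%SET.

(* Only the couplings [g (i, j)] with [i < j] are constrained, and only these
   enter the partition function. *)
Definition SK_disorder (N : nat) (g : 'I_N * 'I_N -> {RV P >-> R}) : Prop :=
  (forall ij, ij \in upper_pairs N -> standard_normal (g ij)) /\
  mutually_independent (upper_pairs N) g.

Definition SK_partition (N : nat) (beta : R)
    (g : 'I_N * 'I_N -> {RV P >-> R}) (w : T) : R :=
  \sum_(s : config N)
    expR (beta / Num.sqrt N%:R *
          \sum_(ij in upper_pairs N)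
            g ij w * spin R (s ij.1) * spin R (s ij.2)).

End Probability.

(* Main.v *)
Require Import Defs.
From mathcomp Require Import measurable_realfun ring lra zify.

Set Implicit Arguments.
Unset Strict Implicit.
Unset Printing Implicit Defensive.

Import HBNNSimple.

Local Open Scope classical_set_scope.
Local Open Scope ring_scope.

(* Expanding [Z_N ^ k] over [k] replicas and transposing, a configuration of the
   replicas becomes a map [t : 'I_N -> {-1,1}^k], and the Gaussian moment
   generating function gives
     E [Z_N ^ k] = sum_t exp (2 / N * sum_(i < j) W (t i) (t j)),
     W s s' = beta ^ 2 / 4 * (s . s') ^ 2,
   which is the partition function of a mean-field model with spins in
   {-1,1}^k.  Let F p be the entropy plus the quadratic form of [W] at [p].
   Lower bound: the Gibbs variational inequality tested on the i.i.d. law [p^N]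
   gives log E [Z_N ^ k] >= N F p - O(1), the error coming from the missing
   diagonal.  Upper bound: if [p] is the empirical measure of [t], the weight of
   [t] is at most exp (N F p) * prod_i p (t i); for a fixed [p] the products
   sum to at most 1, and there are at most (N + 1) ^ (2 ^ k) empirical
   measures. *)

(** * Image measures with a density, and products of independent variables *)

(** On each level set of [h] this is the hypothesis that [nu] is the image under [X] of the measure
    with density [Y] with respect to [mu]. *)
Lemma integral_nnsfun_density d d' (T : measurableType d)
    (T' : measurableType d') (R : realType) (mu : {measure set T -> \bar R})
    (nu : {measure set T' -> \bar R}) (X : T -> T') (Y : T -> R) (h : {nnsfun T' >-> R}) :
  measurable_fun setT X -> measurable_fun setT Y -> (forall w, 0 <= Y w) ->
  (forall A, measurable A -> nu A = \int[mu]_(w in X @^-1` A) (Y w)%:E)%E ->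
  (\int[nu]_x (h x)%:E = \int[mu]_w (h (X w) * Y w)%:E)%E.
Proof.
move=> mX mY Y0 nuE.
have mXp (A : set T') : measurable A -> measurable (X @^-1` A).
  by move=> mA; rewrite -[X in measurable X]setTI; exact: mX.
rewrite integralT_nnsfun sintegralE.
transitivity (\int[mu]_w \sum_(y \in range h)
   (y * \1_(h @^-1` [set y]) (X w) * Y w)%:E)%E; last first.
  apply: eq_integral => w _.
  rewrite fsumEFin// [in RHS]fimfunE; congr EFin.
  by rewrite !fsbig_finite//= mulr_suml.
rewrite ge0_integral_fsum//; last 2 first.
- move=> y; apply/measurable_EFinP; apply: measurable_funM => //.
  apply: measurable_funM => //.
  by apply: measurableT_comp => //; exact: measurable_indic.
(* Here [y] is any real; a negative one is not a value of [h], so its indicator vanishes. *)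
- move=> y w _; rewrite lee_fin mulr_ge0//.
  have [yh|yh] := boolP (h (X w) == y).
    by rewrite -(eqP yh) mulr_ge0.
  rewrite indicE memNset ?mulr0//= => hy; by rewrite hy eqxx in yh.
apply: eq_fsbigr => y /set_mem [z _ yE].
rewrite nuE//.
under [RHS]eq_integral do rewrite -mulrA EFinM.
rewrite ge0_integralZl//; last 3 first.
- apply/measurable_EFinP; apply: measurable_funM => //.
  by apply: measurableT_comp => //; exact: measurable_indic.
- by move=> w _; rewrite lee_fin mulr_ge0.
- by rewrite lee_fin -yE.
congr (_ * _)%E; rewrite integral_mkcond; apply: eq_integral => w _.
rewrite patchE indicE; case: ifPn => /=; rewrite ?inE ?notin_setE /= => hX.
  by rewrite mem_set// mul1r.
by rewrite memNset// mul0r.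
Qed.

(** Monotone convergence along simple approximations of [f]. It is applied with [X] the identity and
    [Y] a normal density, and with [X] one of several independent variables and [Y] a product of
    functions of the others. *)
Lemma ge0_integral_density d d' (T : measurableType d) (T' : measurableType d')
    (R : realType) (mu : {measure set T -> \bar R})
    (nu : {measure set T' -> \bar R}) (X : T -> T') (Y : T -> R) (f : T' -> R) :
  measurable_fun setT X -> measurable_fun setT Y -> (forall w, 0 <= Y w) ->
  (forall A, measurable A -> nu A = \int[mu]_(w in X @^-1` A) (Y w)%:E)%E ->
  measurable_fun setT f -> (forall x, 0 <= f x) ->
  (\int[nu]_x (f x)%:E = \int[mu]_w (f (X w) * Y w)%:E)%E.
Proof.
move=> mX mY Y0 nuE mf f0.
have mfE : measurable_fun setT (EFin \o f) by exact/measurable_EFinP.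
pose h := nnsfun_approx measurableT mfE.
have hcvg x : (h n x)%:E @[n --> \oo] --> (f x)%:E.
  by apply: cvg_nnsfun_approx => // y _; rewrite lee_fin.
have hnd x : nondecreasing_seq (h ^~ x).
  by move=> a b ab; exact/lefP/nd_nnsfun_approx.
have lhs : (\int[nu]_x (h n x)%:E @[n --> \oo] --> \int[nu]_x (f x)%:E)%E.
  rewrite (_ : (fun x => (f x)%:E) = fun x => limn (fun n => (h n x)%:E)).
    apply: cvg_monotone_convergence => //.
    - by move=> n; apply/measurable_EFinP.
    - by move=> n x _; rewrite lee_fin.
    - by move=> x _ a b ab; rewrite lee_fin hnd.
  by apply/funext => x; apply/esym/cvg_lim => //; exact: hcvg.
have rhs : (\int[mu]_w (h n (X w) * Y w)%:E @[n --> \oo] -->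
    \int[mu]_w (f (X w) * Y w)%:E)%E.
  rewrite (_ : (fun w => (f (X w) * Y w)%:E) =
      fun w => limn (fun n => (h n (X w) * Y w)%:E)).
    apply: cvg_monotone_convergence => //.
    - move=> n; apply/measurable_EFinP; apply: measurable_funM => //.
      exact: measurableT_comp.
    - by move=> n x _; rewrite lee_fin mulr_ge0.
    - by move=> x _ a b ab; rewrite lee_fin ler_wpM2r// hnd.
  apply/funext => w; apply/esym/cvg_lim => //.
  apply: (@cvg_trans _ ((h n (X w))%:E * (Y w)%:E @[n --> \oo])%E) => //.
  by rewrite EFinM; apply: cvgeZr => //; exact: hcvg.
move: lhs; under eq_cvg do rewrite (integral_nnsfun_density _ mX mY Y0 nuE).
by move=> lhs; exact: (cvg_unique _ lhs rhs).
Qed.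

Lemma preimage_indic1 (T : Type) (R : realType) (A : set T) :
  (\1_A : T -> R) @^-1` [set 1] = A.
Proof.
apply/seteqP; split => x /=; rewrite indicE.
  by have [/set_mem//|_ /eqP] := boolP (x \in A); rewrite eq_sym oner_eq0.
by move=> Ax; rewrite mem_set.
Qed.

Lemma prod_indic (I : finType) (D : {set I}) (T : Type) (R : realType)
    (B : I -> set T) (w : T) :
  \prod_(i in D) (\1_(B i) w : R) = \1_(\bigcap_(i in [set` D]) B i) w.
Proof.
rewrite indicE; have [/set_mem Bw|] := boolP (_ \in _).
  by rewrite big1// => i iD; rewrite indicE mem_set//; exact: Bw.
rewrite notin_setE -existsNP => -[i /not_implyP[/= iD Biw]].
by rewrite (bigD1 i)//= indicE memNset// mul0r.
Qed.

(* Independence is only assumed for events, so the claim is proved for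
   indicators first; each step replaces one more indicator by a general
   function, the indices of the general functions being listed in [s]. *)
Lemma integral_prod_independent_seq d (T : measurableType d) (R : realType)
    (P : probability T R) (I : finType) (D : {set I}) (X : I -> {RV P >-> R})
    (s : seq I) (f : I -> R -> R) (m : I -> R) :
  mutually_independent D X ->
  (forall i, measurable_fun setT (f i)) -> (forall i x, 0 <= f i x) ->
  (forall i, i \in D -> \int[P]_w (f i (X i w))%:E = (m i)%:E)%E ->
  (forall i, i \in D -> i \notin s -> f i = \1_(f i @^-1` [set 1])) ->
  (\int[P]_w (\prod_(i in D) f i (X i w))%:E = (\prod_(i in D) m i)%:E)%E.
Proof.
move=> indX; elim: s f m => [|j s IH] f m mf f0 fm fs.
  have mA i : measurable (f i @^-1` [set 1]).
    by rewrite -[X in measurable X]setTI; exact: mf.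
  have mXA i : measurable (X i @^-1` (f i @^-1` [set 1])).
    exact: measurable_funPTI.
  have Pm i : i \in D -> P (X i @^-1` (f i @^-1` [set 1])) = (m i)%:E.
    move=> iD; rewrite -fm// -(setIT (X i @^-1` _)) -integral_indic//.
    apply: eq_integral => w _; congr EFin.
    by rewrite [in RHS]fs.
  rewrite -prodEFin -(eq_bigr _ Pm) -indX//.
  rewrite -(setIT (\bigcap_(_ in _) _)) -integral_indic//; last first.
    by apply: fin_bigcap_measurable => // i _.
  apply: eq_integral => w _; congr EFin; rewrite -prod_indic.
  by apply: eq_bigr => i iD; rewrite [in LHS]fs.
have [jD|jD] := boolP (j \in D); last first.
  apply: IH => // i iD is_; apply: fs => //.
  by rewrite inE negb_or is_ andbT; apply: contraNneq jD => <-.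
have m0 i : i \in D -> 0 <= m i.
  by move=> iD; rewrite -lee_fin -fm// integral_ge0// => w _; rewrite lee_fin.
have c0 : 0 <= \prod_(i in D | i != j) m i.
  by apply: prodr_ge0 => i /andP[/m0].
pose Y w := \prod_(i in D | i != j) f i (X i w).
have mfX i : measurable_fun setT (fun w => f i (X i w)).
  exact: measurableT_comp.
have mY : measurable_fun setT Y.
  rewrite /Y; under eq_fun do rewrite -big_filter.
  by apply: measurable_prod => i _; exact: mfX.
have Y0 w : 0 <= Y w by apply: prodr_ge0.
(* The factors other than [j] form a density [Y]. By independence, [X j] keeps its law under this
   density, up to the constant mean of [Y]; this is [nuE]. *)
pose nu := mscale (NngNum c0) (distribution P (X j)).
have nuE A : measurable A -> (nu A = \int[P]_(w in X j @^-1` A) (Y w)%:E)%E.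
  move=> mA; have mXA : measurable (X j @^-1` A) by exact: measurable_funPTI.
  (* With [f j] replaced by the indicator of [A], the index [j] leaves the list and the induction
     hypothesis applies. *)
  pose f' i := if i == j then \1_A else f i : R -> R.
  pose m' i := if i == j then fine (P (X j @^-1` A)) else m i.
  transitivity (\prod_(i in D) m' i)%:E.
    rewrite (bigD1 j)//= /m' eqxx EFinM fineK ?fin_num_measure// muleC.
    rewrite /nu /mscale/=; congr (_%:E * _)%E.
    by apply: eq_bigr => i /andP[_ /negbTE ->].
  rewrite -(IH f' m')//.
  - rewrite [RHS]integral_mkcond; apply: eq_integral => w _.
    rewrite (bigD1 j)//= /f' eqxx patchE indicE.
    rewrite (eq_bigr (fun i => f i (X i w))); last first.
      by move=> i /andP[_ /negbTE ->].
    case: ifPn; rewrite ?inE ?notin_setE /= => XA.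
      by rewrite mem_set// mul1r.
    by rewrite memNset// mul0r.
  - by move=> i; rewrite /f'; case: ifP => // _; exact: measurable_indic.
  - by move=> i x; rewrite /f'; case: ifP.
  - move=> i iD; rewrite /f' /m'; case: ifPn => [/eqP ->|_]; last exact: fm.
    rewrite fineK ?fin_num_measure// -[X in P X]setIT -integral_indic//.
  - move=> i iD is_; rewrite /f'; case: ifPn => [_|ij].
      by rewrite preimage_indic1.
    by apply: fs => //; rewrite inE negb_or ij.
under eq_integral do rewrite (bigD1 j)//=.
rewrite (bigD1 j)//= -(ge0_integral_density _ mY Y0 nuE)//.
rewrite ge0_integral_mscale//=; last 2 first.
- exact/measurable_EFinP.
- by move=> x _; rewrite lee_fin.
rewrite ge0_integral_distribution//=; last 2 first.
- exact/measurable_EFinP.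
- by move=> x; rewrite lee_fin.
by rewrite fm// -EFinM mulrC.
Qed.

Lemma integral_prod_independent d (T : measurableType d) (R : realType)
    (P : probability T R) (I : finType) (D : {set I}) (X : I -> {RV P >-> R})
    (f : I -> R -> R) (m : I -> R) :
  mutually_independent D X ->
  (forall i, measurable_fun setT (f i)) -> (forall i x, 0 <= f i x) ->
  (forall i, i \in D -> \int[P]_w (f i (X i w))%:E = (m i)%:E)%E ->
  (\int[P]_w (\prod_(i in D) f i (X i w))%:E = (\prod_(i in D) m i)%:E)%E.
Proof.
move=> indX mf f0 fm.
(* Once all of [D] is listed, no factor has to be an indicator. *)
apply: (@integral_prod_independent_seq _ _ _ _ _ _ _ (enum D)) => // i iD.
by rewrite mem_enum iD.
Qed.

(** Completing the square: [expR (c * x)] times the standard normal density is [expR (c ^+ 2 / 2)]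
    times the normal density of mean [c] and variance 1. *)
Lemma integral_expR_standard_normal d (T : measurableType d) (R : realType)
    (P : probability T R) (X : {RV P >-> R}) (c : R) :
  standard_normal X ->
  (\int[P]_w (expR (c * X w))%:E = (expR (c ^+ 2 / 2))%:E)%E.
Proof.
move=> nX.
have mexp : measurable_fun setT (fun x : R => expR (c * x)).
  by apply: measurableT_comp => //; exact: measurable_funM.
rewrite -[LHS](ge0_integral_distribution X (f := fun x => (expR (c * x))%:E)).
- rewrite (@ge0_integral_density _ _ _ _ _ lebesgue_measure
    (distribution P X) idfun (normal_pdf 0 1))//=.
  + transitivity (\int[lebesgue_measure]_x
        ((expR (c ^+ 2 / 2))%:E * (normal_pdf c 1 x)%:E))%E.
      apply: eq_integral => x _; rewrite -EFinM !normal_pdfE ?oner_eq0//.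
      rewrite /normal_fun mulrCA [in RHS]mulrCA -!expRD; congr (_ * expR _)%:E.
      by field.
    rewrite ge0_integralZl//.
    * by rewrite integral_normal_pdf mule1.
    * by apply/measurable_EFinP; exact: measurable_normal_pdf.
    * by move=> x _; rewrite lee_fin normal_pdf_ge0.
  + exact: measurable_id.
  + exact: measurable_normal_pdf.
  + by move=> x; exact: normal_pdf_ge0.
- exact/measurable_EFinP.
- by move=> y; rewrite lee_fin expR_ge0.
Qed.

(** * The Gibbs variational inequality and expectations under product laws *)

(** The gap is the relative entropy of [mu] with respect to the Gibbs law [expR (h j) / Z]. It is
    non-negative by [ln y <= y - 1] at [y = expR (h j) / Z / mu j], whenever [mu j] is non-zero. *)
Lemma gibbs_variational (R : realType) (J : finType) (mu h : J -> R) :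
  (forall j, 0 <= mu j) -> \sum_j mu j = 1 ->
  \sum_j mu j * (h j - ln (mu j)) <= ln (\sum_j expR (h j)).
Proof.
move=> mu0 mu1; set Z := \sum_j expR (h j).
have Z0 : 0 < Z.
  have [j _] : exists j : J, true.
    have [j|J0] := pickP (@predT J); first by exists j.
    by move: mu1; rewrite big_pred0// => /eqP; rewrite eq_sym oner_eq0.
  rewrite /Z (bigD1 j)//= ltr_pwDl ?expR_gt0//.
  by rewrite sumr_ge0// => *; exact: expR_ge0.
rewrite -subr_le0 -[X in _ - X]mul1r -mu1 mulr_suml -sumrB.
apply: (@le_trans _ _ (\sum_j (expR (h j) / Z - mu j))); last first.
  by rewrite sumrB mu1 -mulr_suml divff ?subrr// gt_eqF.
apply: ler_sum => j _; have [->|muj] := eqVneq (mu j) 0.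
  by rewrite !mul0r !subr0 divr_ge0 ?expR_ge0// ltW.
have {muj}muj : 0 < mu j by rewrite lt_neqAle eq_sym muj mu0.
have y0 : 0 < expR (h j) / Z / mu j by rewrite !divr_gt0 ?expR_gt0.
have := @le_ln1Dx R (expR (h j) / Z / mu j - 1).
rewrite ltrBDr addNr y0 subrKC => /(_ isT).
rewrite !ln_div ?posrE ?divr_gt0 ?expR_gt0// expRK => le_y.
have := ler_wpM2l (ltW muj) le_y.
rewrite [leRHS]mulrBr mulr1 [mu j * (_ / _)]mulrC divfK ?gt_eqF//.
by apply: le_trans; rewrite !mulrBr; lra.
Qed.

Lemma sum_prod_ffun (R : realType) (I S : finType) (p : S -> R)
    (phi : I -> S -> R) :
  \sum_(t : {ffun I -> S}) (\prod_i p (t i)) * (\prod_i phi i (t i)) =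
  \prod_i \sum_s p s * phi i s.
Proof.
by rewrite bigA_distr_bigA; apply: eq_bigr => t _; rewrite -big_split.
Qed.

Lemma sum_prod_ffun_eq1 (R : realType) (I S : finType) (p : S -> R) :
  \sum_s p s = 1 -> \sum_(t : {ffun I -> S}) \prod_i p (t i) = 1.
Proof.
by move=> p1; rewrite -(bigA_distr_bigA (fun _ : I => p)) big1.
Qed.

Lemma marginal_product (R : realType) (I S : finType) (p F : S -> R) (i : I) :
  \sum_s p s = 1 ->
  \sum_(t : {ffun I -> S}) (\prod_l p (t l)) * F (t i) = \sum_s p s * F s.
Proof.
move=> p1; pose phi l s := if l == i then F s else 1.
transitivity (\prod_l \sum_s p s * phi l s).
  rewrite -sum_prod_ffun; apply: eq_bigr => t _; congr (_ * _).
  rewrite (bigD1 i)//= /phi eqxx big1 ?mulr1// => l /negbTE -> //.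
rewrite (bigD1 i)//= /phi eqxx [X in _ * X]big1 ?mulr1// => l /negbTE ->.
by under eq_bigr do rewrite mulr1.
Qed.

(** [G (t i) (t j)] is not a product over coordinates, but it is the sum over [u] of the indicator
    of [t i = u] times [G u (t j)], and each of these terms factorises. *)
Lemma marginal_product2 (R : realType) (I S : finType) (p : S -> R)
    (G : S -> S -> R) (i j : I) :
  i != j -> \sum_s p s = 1 ->
  \sum_(t : {ffun I -> S}) (\prod_l p (t l)) * G (t i) (t j) =
  \sum_s \sum_s' p s * p s' * G s s'.
Proof.
move=> ij p1.
pose phi u l s := if l == i then (s == u)%:R else if l == j then G u s else 1.
transitivity (\sum_u \prod_l \sum_s p s * phi u l s).
  under [RHS]eq_bigr do rewrite -sum_prod_ffun.
  rewrite exchange_big; apply: eq_bigr => t _; rewrite -mulr_sumr.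
  congr (_ * _).
  rewrite (bigD1 (t i))//= [X in _ + X]big1 ?addr0 => [|u ui].
    rewrite (bigD1 i)//= (bigD1 j)//=; last by rewrite eq_sym.
    rewrite /phi !eqxx mul1r eq_sym (negbTE ij) big1 ?mulr1//.
    by move=> l /andP[/negbTE -> /negbTE ->].
  by rewrite (bigD1 i)//= /phi eqxx eq_sym (negbTE ui) mul0r.
apply: eq_bigr => u _.
rewrite (bigD1 i)//= (bigD1 j)//=; last by rewrite eq_sym.
rewrite [X in _ * (_ * X)]big1 ?mulr1; last first.
  move=> l /andP[/negbTE li /negbTE lj]; rewrite /phi li lj.
  by under eq_bigr do rewrite mulr1.
rewrite /phi !eqxx [j == i]eq_sym (negbTE ij).
rewrite (bigD1 u)//= eqxx mulr1 [X in _ + X]big1 ?addr0; last first.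
  by move=> s /negbTE ->; rewrite mulr0.
by rewrite mulr_sumr; apply: eq_bigr => s _; rewrite mulrA.
Qed.

(** Swapping coordinates exchanges the two triangles off the diagonal. This turns energies over
    pairs into full quadratic forms and, with [F] constant, counts the pairs. *)
Lemma sum_upper_pairs (R : realType) (N : nat) (F : 'I_N -> 'I_N -> R) :
  (forall i j, F i j = F j i) ->
  \sum_i \sum_j F i j =
  2 * (\sum_(ij in upper_pairs N) F ij.1 ij.2) + \sum_i F i i.
Proof.
move=> symF; rewrite pair_big/= (bigID [pred ij | ij.1 == ij.2])/= addrC.
congr (_ + _); last first.
  rewrite [RHS](reindex_onto fst (fun i => (i, i)))//=.
  apply: eq_big => [|[i j] /=].
    by move=> [i j]/=; rewrite xpair_eqE eqxx.
  by move=> /eqP ->.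
rewrite (bigID [pred ij : 'I_N * 'I_N | (ij.1 < ij.2)%N])/=.
rewrite mulr_natl mulr2n; congr (_ + _).
  by apply: eq_bigl => -[i j]/=; rewrite inE/= ltn_neqAle -val_eqE; case: eqP.
rewrite [LHS](reindex (fun ij => (ij.2, ij.1)))/=; last first.
  by exists (fun ij => (ij.2, ij.1)) => -[].
rewrite [RHS](eq_bigr (fun ij => F ij.2 ij.1)); last first.
  by move=> ij _; exact: symF.
by apply: eq_bigl => -[i j]/=; rewrite inE/= -leqNgt ltn_neqAle -val_eqE eq_sym.
Qed.

(** * Finite-size bounds for the mean-field partition function *)

Definition mean_field_functional (R : realType) (S : finType) (W : S -> S -> R)
    (p : S -> R) : R :=
  - (\sum_s p s * ln (p s)) + \sum_s \sum_s' p s * p s' * W s s'.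

(** For symmetric [W], the factor [2 / N] makes the exponent [N] times the quadratic form of [W] at
    the empirical measure of [t], minus a diagonal term. *)
Definition mean_field_partition (R : realType) (S : finType) (W : S -> S -> R)
    (N : nat) : R :=
  \sum_(t : {ffun 'I_N -> S})
    expR (2 / N%:R * \sum_(ij in upper_pairs N) W (t ij.1) (t ij.2)).

(** Under the product law of [p] the entropy is [N] times that of [p], and the [N (N - 1) / 2] pairs
    have mean energy [N - 1] times the quadratic form. Dividing by [N] leaves the stated
    correction. *)
Lemma mean_field_lower_bound (R : realType) (S : finType) (W : S -> S -> R)
    (N : nat) (p : S -> R) :
  (0 < N)%N -> simplex R S p ->
  mean_field_functional W p - N%:R^-1 * (\sum_s \sum_s' p s * p s' * W s s')
    <= N%:R^-1 * ln (mean_field_partition W N).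
Proof.
move=> N0 [p0 p1].
have NR : 0 < N%:R :> R by rewrite ltr0n.
pose mu (t : {ffun 'I_N -> S}) := \prod_i p (t i).
pose h (t : {ffun 'I_N -> S}) :=
  2 / N%:R * \sum_(ij in upper_pairs N) W (t ij.1) (t ij.2).
have mu0 t : 0 <= mu t by apply: prodr_ge0.
have mu_ln t : mu t * ln (mu t) = \sum_i mu t * ln (p (t i)).
  (* If some [p (t i)] vanishes, the logarithm of the product need not split, but then both sides
     carry the factor [mu t = 0]. *)
  rewrite -mulr_sumr; have [->|mut] := eqVneq (mu t) 0; first by rewrite !mul0r.
  congr (_ * _); rewrite /mu.
  have pt i : 0 < p (t i).
    by rewrite lt_neqAle p0 andbT eq_sym; move/prodf_neq0: mut; exact.
  rewrite -[LHS]expRK -[RHS]expRK; congr ln.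
  rewrite lnK ?posrE ?prodr_gt0// expR_sum.
  by apply: eq_bigr => i _; rewrite lnK// posrE.
rewrite ler_pdivlMl//.
apply: le_trans (gibbs_variational h mu0 (sum_prod_ffun_eq1 _ p1)).
under [leRHS]eq_bigr do rewrite mulrBr mu_ln.
rewrite sumrB [X in _ <= _ - X]exchange_big/=.
rewrite [X in _ <= _ - X](eq_bigr (fun=> \sum_s p s * ln (p s))); last first.
  by move=> i _; exact: (marginal_product (fun s => ln (p s)) i p1).
rewrite sumr_const card_ord.
under [X in _ <= X - _]eq_bigr do rewrite /h mulrCA mulr_sumr.
rewrite -mulr_sumr [X in _ <= _ * X - _]exchange_big/=.
rewrite [X in _ <= _ * X - _](eq_bigr
  (fun=> \sum_s \sum_s' p s * p s' * W s s')); last first.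
  move=> [i j]; rewrite inE/= => ij; apply: (marginal_product2 _ _ p1).
  by rewrite -val_eqE neq_ltn ij.
rewrite /mean_field_functional; set Q := \sum_s \sum_s' _.
rewrite [in leRHS]sumr_const -[Q *+ _]mulr_natl.
have cardE : N%:R * N%:R = 2 * #|upper_pairs N|%:R + N%:R :> R.
  have := @sum_upper_pairs R N (fun _ _ => 1) (fun _ _ => erefl).
  by rewrite !sumr_const card_ord -mulrnA natrM.
have {cardE}cardE : 2 * #|upper_pairs N|%:R = N%:R * (N%:R - 1) :> R.
  by rewrite mulrBr mulr1 cardE addrK.
rewrite mulrA [2 / _ * _]mulrAC cardE le_eqVlt; apply/orP; left; apply/eqP.
rewrite -mulr_natl; field; by rewrite gt_eqF.
Qed.

Lemma sum_comp_occurrences (R : realType) (I S : finType) (t : I -> S)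
    (F : S -> R) :
  \sum_i F (t i) = \sum_s #|[set i | t i == s]%SET|%:R * F s.
Proof.
rewrite (partition_big t xpredT)//=; apply: eq_bigr => s _.
rewrite (eq_bigr (fun=> F s)) => [|i /eqP -> //].
rewrite sumr_const mulr_natl; congr (_ *+ _).
by apply: eq_card => i; rewrite !inE.
Qed.

(** Let [p] be the empirical measure of [t]. The product on the right is [exp] of [-N] times the
    entropy of [p], and adding the non-negative diagonal bounds the energy by [N] times the
    quadratic form at [p]. The claim is then the bound [M] at [p]. *)
Lemma mean_field_weight_le (R : realType) (S : finType) (W : S -> S -> R)
    (N : nat) (M : R) (t : {ffun 'I_N -> S}) :
  (0 < N)%N -> (forall s s', W s s' = W s' s) -> (forall s, 0 <= W s s) ->
  (forall p, simplex R S p -> mean_field_functional W p <= M) ->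
  expR (2 / N%:R * \sum_(ij in upper_pairs N) W (t ij.1) (t ij.2)) <=
  expR (N%:R * M) * \prod_i (#|[set l | t l == t i]%SET|%:R / N%:R).
Proof.
move=> N0 symW W0 leM.
have NR : 0 < N%:R :> R by rewrite ltr0n.
pose p s : R := #|[set i | t i == s]%SET|%:R / N%:R.
have p0 s : 0 <= p s by rewrite divr_ge0.
have p1 : \sum_s p s = 1.
  have := sum_comp_occurrences t (fun=> N%:R^-1 : R).
  by rewrite sumr_const card_ord -[_ *+ N]mulr_natl divff ?gt_eqF.
have pt i : 0 < p (t i).
  by rewrite divr_gt0// ltr0n card_gt0; apply/set0Pn; exists i; rewrite inE.
have EF (F : S -> R) : \sum_i F (t i) = N%:R * \sum_s p s * F s.
  rewrite sum_comp_occurrences mulr_sumr; apply: eq_bigr => s _.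
  by rewrite /p; field; rewrite gt_eqF.
rewrite (eq_bigr (fun i => expR (ln (p (t i))))); last first.
  by move=> i _; rewrite lnK// posrE.
rewrite -expR_sum -expRD ler_expR.
rewrite (EF (fun s => ln (p s))) -mulrDr.
apply: (@le_trans _ _ (N%:R * \sum_s \sum_s' p s * p s' * W s s')); last first.
  rewrite ler_pM2l//; have := leM p (conj p0 p1).
  rewrite /mean_field_functional; lra.
have /esym : \sum_i \sum_j W (t i) (t j) =
    N%:R ^+ 2 * \sum_s \sum_s' p s * p s' * W s s'.
  under eq_bigr do rewrite (EF (W _)).
  rewrite (EF (fun s => N%:R * \sum_s' p s' * W s s')) expr2 -mulrA.
  congr (_ * _); rewrite mulr_sumr; apply: eq_bigr => s _; rewrite mulrCA; congr (_ * _).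
  by rewrite mulr_sumr; apply: eq_bigr => s' _; rewrite mulrA.
rewrite (@sum_upper_pairs R N (fun i j => W (t i) (t j)))// => eqW.
have diag0 : 0 <= \sum_i W (t i) (t i) by exact: sumr_ge0.
rewrite [leLHS]mulrAC ler_pdivrMr// [leRHS]mulrAC -expr2 eqW; lra.
Qed.

(* Grouping the configurations by their occurrence vector [nu], each class
   contributes at most [expR (N * M)] times the mass of an i.i.d. law. *)
Lemma mean_field_upper_bound (R : realType) (S : finType) (W : S -> S -> R)
    (N : nat) (M : R) :
  (0 < N)%N -> (forall s s', W s s' = W s' s) -> (forall s, 0 <= W s s) ->
  (forall p, simplex R S p -> mean_field_functional W p <= M) ->
  mean_field_partition W N <= expR (N%:R * M) * (N.+1 ^ #|S|)%:R.
Proof.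
move=> N0 symW W0 leM.
have NR : 0 < N%:R :> R by rewrite ltr0n.
(* Each count lies between 0 and [N], so [inord] does not alter it and there are [N.+1 ^ #|S|]
   classes. *)
pose occ (t : {ffun 'I_N -> S}) : {ffun S -> 'I_N.+1} :=
  [ffun s => inord #|[set i | t i == s]%SET|].
have occE t s : occ t s = #|[set i | t i == s]%SET| :> nat.
  rewrite ffunE inordK// ltnS -[X in (_ <= X)%N](card_ord N); exact: max_card.
rewrite /mean_field_partition (partition_big occ xpredT)//=.
have -> : expR (N%:R * M) * (N.+1 ^ #|S|)%:R =
    \sum_(nu : {ffun S -> 'I_N.+1}) expR (N%:R * M).
  by rewrite sumr_const card_ffun card_ord mulr_natr.
apply: ler_sum => nu _.
(* An empty class contributes nothing; a member [t0] shows that [nu / N] has total mass 1. *)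
have [t0 /eqP t0nu|nu0] := pickP (fun t => occ t == nu); last first.
  by rewrite big_pred0// expR_ge0.
pose p s : R := (nu s)%:R / N%:R.
have p0 s : 0 <= p s by rewrite divr_ge0.
have p1 : \sum_s p s = 1.
  have := sum_comp_occurrences t0 (fun=> N%:R^-1 : R).
  rewrite sumr_const card_ord -[_ *+ N]mulr_natl divff ?gt_eqF// => ->.
  by apply: eq_bigr => s _; rewrite /p -t0nu occE.
apply: (@le_trans _ _ (\sum_(t | occ t == nu)
    expR (N%:R * M) * \prod_i p (t i))).
  apply: ler_sum => t /eqP tnu.
  apply: le_trans (mean_field_weight_le t N0 symW W0 leM) _.
  by under eq_bigr do rewrite -occE tnu.
rewrite -mulr_sumr -[leRHS]mulr1 ler_wpM2l ?expR_ge0//.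
(* The class is part of the whole space, on which the product law of [p] has mass 1. *)
rewrite -[leRHS](sum_prod_ffun_eq1 'I_N p1).
rewrite [leRHS](bigID (fun t => occ t == nu))/=.
by rewrite lerDl sumr_ge0// => t _; exact: prodr_ge0.
Qed.

(** * Continuity of x log x and decay of log (N + 1) / N *)

(** [ln x] is twice the logarithm of the square root, and [ln y < y]. The bound controls both
    [x * ln x] near 0 and [ln N.+1 / N] at infinity. *)
Lemma ln_le_sqrt (R : realType) (x : R) : 0 < x -> ln x <= 2 * Num.sqrt x.
Proof.
move=> x0; have s0 : 0 < Num.sqrt x by rewrite sqrtr_gt0.
rewrite -{1}(sqr_sqrtr (ltW x0)) lnXn// mulr2n mulr_natl mulr2n.
by rewrite lerD// ltW// ln_sublinear.
Qed.

(* Continuity at [0] relies on the junk value [ln x = 0] for [x <= 0]. *)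
Lemma continuous_mul_ln (R : realType) : continuous (fun x : R => x * ln x).
Proof.
move=> x; rewrite /continuous_at; have [x0|x0|->] := ltgtP x 0.
- rewrite (ln0 (ltW x0)) mulr0; apply: cvg_near_cst.
  have : \forall y \near x, y < 0 by exact: lt_nbhsl.
  by apply: filterS => y y0; rewrite ln0 ?mulr0// ltW.
- by apply: cvgM; [exact: cvg_id|exact: continuous_ln].
- rewrite mul0r.
  apply: (@squeeze_cvgr _ _ _ _ (fun y => - (2 * Num.sqrt y)) (fun=> 0)).
  + have : \forall y \near (0 : R), y < 1 by exact: lt_nbhsl.
    apply: filterS => y y1; have [y0|y0] := leP y 0.
      by rewrite ln0// mulr0 lexx ler0_sqrtr// mulr0 oppr0 lexx.
    have sy : 0 < Num.sqrt y by rewrite sqrtr_gt0.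
    apply/andP; split; last by rewrite mulr_ge0_le0 ?ln_le0// ltW.
    rewrite lerNl -mulrN -lnV ?posrE//.
    (* At [y^-1] the bound reads [- ln y <= 2 / sqrt y]; multiplying by [y] gives the lower
       envelope. *)
    have := @ln_le_sqrt R y^-1; rewrite invr_gt0 => /(_ y0).
    move=> /(ler_wpM2l (ltW y0)) /le_trans; apply; rewrite (sqrtrV (ltW y0)) mulrCA ler_pM2l// -{1}(sqr_sqrtr (ltW y0)).
    by rewrite expr2 mulfK// gt_eqF.
  + rewrite -[X in _ --> X]oppr0 -[X in - X](mulr0 2) -[X in 2 * X](@sqrtr0 R).
    by apply: cvgN; apply: cvgM; [exact: cvg_cst|exact: sqrt_continuous].
  + exact: cvg_cst.
Qed.

Lemma log_succ_div_cvg0 (R : realType) :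
  (N%:R^-1 * ln N.+1%:R : R) @[N --> \oo] --> (0 : R).
Proof.
rewrite -cvg_shiftS/=.
(* After the shift, [ln_le_sqrt] gives at most [2 sqrt (n + 2) / (n + 1)], and [n + 2 <= 4 (n + 1)]
   yields the constant 4. *)
apply: (@squeeze_cvgr _ _ _ _ (fun=> 0) (fun n => 4 * Num.sqrt (harmonic n))).
- near=> n; rewrite /harmonic; apply/andP; split.
    by rewrite mulr_ge0// ln_ge0// ler1n.
  have n0 : 0 < n.+1%:R :> R by rewrite ltr0n.
  have sn : 0 < Num.sqrt n.+1%:R :> R by rewrite sqrtr_gt0.
  rewrite ler_pdivrMl//; apply: (le_trans (ln_le_sqrt _)).
    by rewrite ltr0n.
  have -> : n.+1%:R * (4 * Num.sqrt n.+1%:R^-1) = 4 * Num.sqrt n.+1%:R :> R.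
    rewrite (sqrtrV (ltW n0)) mulrCA; congr (_ * _).
    by rewrite -{1}(sqr_sqrtr (ltW n0)) expr2 mulfK// gt_eqF.
  have -> : 4 = 2 * 2 :> R by rewrite -natrM.
  rewrite -mulrA ler_pM2l// -ler_sqr ?nnegrE ?mulr_ge0// exprMn !sqr_sqrtr//.
  by rewrite -natrX -natrM ler_nat; lia.
- exact: cvg_cst.
- rewrite -[X in _ --> X](mulr0 4) -[X in 4 * X](@sqrtr0 R).
  apply: cvgM; first exact: cvg_cst.
  by apply: continuous_cvg; [exact: sqrt_continuous|exact: cvg_harmonic].
Unshelve. all: by end_near. Qed.

(** * Existence of a maximiser on the simplex *)

Section simplex_topology.
Import ArrowAsProduct.

(** In the product topology on [S -> R], this is a closed subset of the cube, which is compact by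
    Tychonoff. *)
Lemma compact_simplex (R : realType) (S : finType) : compact (simplex R S).
Proof.
have -> : simplex R S =
    [set p | forall s, `[0, 1]%classic (p s)] `&`
    (fun p => \sum_s p s) @^-1` [set 1].
  apply/seteqP; split => p [p0 p1]; split => // s.
    rewrite /= in_itv/= p0/= -p1 (bigD1 s)//= lerDl sumr_ge0//.
  by have := p0 s; rewrite /= in_itv/= => /andP[].
apply: compact_closedI.
  apply: (@tychonoff S (fun=> R) (fun=> `[0, 1]%classic)) => s.
  exact: segment_compact.
apply: preimage_closed; last exact: closed_eq.
move=> p _; apply: continuous_big; first exact: add_continuous.
by move=> s _; exact: (@proj_continuous S (fun=> R)).
Qed.

Lemma continuous_mean_field_functional (R : realType) (S : finType)
    (W : S -> S -> R) : continuous (mean_field_functional W).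
Proof.
have proj s : continuous (fun p : S -> R => p s).
  exact: (@proj_continuous S (fun=> R)).
have cH : continuous (fun p : S -> R => \sum_s p s * ln (p s)).
  apply: continuous_big; first exact: add_continuous.
  move=> s _ q.
  apply: (@continuous_comp _ _ _ (fun p : S -> R => p s) (fun x => x * ln x)).
    exact: proj.
  exact: continuous_mul_ln.
have cQ : continuous (fun p : S -> R => \sum_s \sum_s' p s * p s' * W s s').
  apply: continuous_big; first exact: add_continuous.
  move=> s _; apply: continuous_big; first exact: add_continuous.
  move=> s' _ q.
  apply: (@continuousM _ _ (fun p : S -> R => p s * p s') (fun=> W s s'));
    last exact: cst_continuous.
  by apply: (@continuousM _ _ (fun p : S -> R => p s)); exact: proj.
move=> p; rewrite /mean_field_functional.
apply: (@continuousD R R _ (fun p : S -> R => - (\sum_s p s * ln (p s))));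
  last exact: cQ.
apply: (@continuousN R R _ (fun p : S -> R => \sum_s p s * ln (p s))).
exact: cH.
Qed.

Lemma mean_field_functional_max (R : realType) (S : finType) (W : S -> S -> R) :
  (0 < #|S|)%N ->
  exists2 p, simplex R S p &
    forall q, simplex R S q ->
      mean_field_functional W q <= mean_field_functional W p.
Proof.
move=> /card_gt0P[s0 _].
have simplex0 : simplex R S !=set0.
  exists (fun s => (s == s0)%:R); split; first by move=> s; rewrite ler0n.
  by rewrite (bigD1 s0)//= eqxx big1 ?addr0// => s /negbTE ->.
have [p /set_mem Sp maxp] := compact_EVT_max simplex0 (@compact_simplex R S)
  (continuous_subspaceT (@continuous_mean_field_functional R S W)).
by exists p => // q Sq; apply: maxp; exact: mem_set.
Qed.

End simplex_topology.

(** * The limiting free energy of the mean-field model *)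

Lemma mean_field_partition_gt0 (R : realType) (S : finType) (W : S -> S -> R)
    (N : nat) :
  (0 < #|S|)%N -> 0 < mean_field_partition W N.
Proof.
move=> /card_gt0P[s _]; rewrite /mean_field_partition (bigD1 [ffun=> s])//=.
by rewrite ltr_pwDl ?expR_gt0// sumr_ge0// => t _; exact: expR_ge0.
Qed.

(** The maximiser serves twice: as trial law in the lower bound, and through its value [M] in the
    upper bound. The errors are [Q / N] and [#|S| ln (N + 1) / N]. *)
Lemma mean_field_limit (R : realType) (S : finType) (W : S -> S -> R)
    (p : S -> R) :
  (forall s s', W s s' = W s' s) -> (forall s, 0 <= W s s) ->
  simplex R S p ->
  (forall q, simplex R S q ->
    mean_field_functional W q <= mean_field_functional W p) ->
  (N%:R^-1 * ln (mean_field_partition W N)) @[N --> \oo] -->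
    mean_field_functional W p.
Proof.
move=> symW W0 Sp maxp.
have S0 : (0 < #|S|)%N.
  rewrite lt0n; apply/eqP => /card0_eq S0; case: Sp => _ /eqP.
  by rewrite big1 ?(eq_sym 0) ?oner_eq0// => s; have := S0 s; rewrite inE.
set M := mean_field_functional W p.
set Q := \sum_s \sum_s' p s * p s' * W s s'.
apply: (@squeeze_cvgr _ _ _ _ (fun N => M - N%:R^-1 * Q)
  (fun N => M + #|S|%:R * (N%:R^-1 * ln N.+1%:R))).
- near=> N.
  have N0 : (0 < N)%N by near: N; exact: nbhs_infty_gt.
  have NR : 0 < N%:R :> R by rewrite ltr0n.
  rewrite mean_field_lower_bound//= ler_pdivrMl//.
  have := mean_field_upper_bound N0 symW W0 maxp.
  rewrite -ler_ln ?posrE ?mean_field_partition_gt0//; last first.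
    by rewrite mulr_gt0 ?expR_gt0// ltr0n expn_gt0.
  rewrite lnM ?posrE ?expR_gt0// ?ltr0n ?expn_gt0//.
  rewrite expRK natrX lnXn// -[ln _ *+ _]mulr_natl => /le_trans; apply.
  by rewrite -/M le_eqVlt; apply/orP; left; apply/eqP; field; rewrite gt_eqF.
- rewrite -[X in _ --> X]subr0 -[X in _ - X](mul0r Q).
  apply: cvgB; first exact: cvg_cst.
  apply: cvgM; last exact: cvg_cst.
  by rewrite -cvg_shiftS; exact: cvg_harmonic.
- rewrite -[X in _ --> X]addr0 -[X in _ + X](mulr0 #|S|%:R).
  apply: cvgD; first exact: cvg_cst.
  by apply: cvgM; [exact: cvg_cst|exact: log_succ_div_cvg0].
Unshelve. all: by end_near. Qed.

(** * Moments of the partition function as a mean-field partition function *)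

Lemma integral_expR_disorder d (T : measurableType d) (R : realType)
    (P : probability T R) (N : nat) (g : 'I_N * 'I_N -> {RV P >-> R})
    (c : 'I_N * 'I_N -> R) :
  SK_disorder g ->
  (\int[P]_w (expR (\sum_(ij in upper_pairs N) c ij * g ij w))%:E =
   (expR (\sum_(ij in upper_pairs N) c ij ^+ 2 / 2))%:E)%E.
Proof.
move=> [normal_g indep_g]; rewrite expR_sum.
rewrite -(integral_prod_independent (f := fun ij x => expR (c ij * x)) indep_g).
- by apply: eq_integral => w _; rewrite expR_sum.
- move=> ij; apply: measurableT_comp => //; exact: measurable_funM.
- by move=> ij x; rewrite expR_ge0.
- by move=> ij /normal_g nij; exact: integral_expR_standard_normal.
Qed.

Definition transpose_configs (m n : nat) (t : {ffun 'I_m -> config n}) :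
    {ffun 'I_n -> config m} :=
  [ffun a => [ffun i => t i a]].

Lemma transpose_configsK (m n : nat) :
  cancel (@transpose_configs m n) (@transpose_configs n m).
Proof. by move=> t; apply/ffunP => i; apply/ffunP => a; rewrite !ffunE. Qed.

(** The power expands into a sum over [k] replicas, where [g ij] is multiplied by the sum over
    replicas of the products of the spins at the two sites. After transposition this sum is a scalar
    product in dimension [k]. *)
Lemma SK_partition_expr (R : realType) (N k : nat) (beta : R) d
    (T : measurableType d) (P : probability T R)
    (g : 'I_N * 'I_N -> {RV P >-> R}) (w : T) :
  SK_partition beta g w ^+ k =
  \sum_(t : {ffun 'I_N -> config k}) expR (\sum_(ij in upper_pairs N)
    beta / Num.sqrt N%:R * config_dot R (t ij.1) (t ij.2) * g ij w).
Proof.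
rewrite (reindex (@transpose_configs k N)) /=; last first.
  by exists (@transpose_configs N k) => t _; exact: transpose_configsK.
rewrite /SK_partition -[in LHS](card_ord k) -prodr_const bigA_distr_bigA.
apply: eq_bigr => S _; rewrite -expR_sum; congr expR.
rewrite -mulr_sumr exchange_big /= mulr_sumr; apply: eq_bigr => ij _.
rewrite -[RHS]mulrA; congr (_ * _); rewrite mulr_suml.
by apply: eq_bigr => a _; rewrite !ffunE; ring.
Qed.

Lemma expectation_SK_partition_expr (R : realType) (N k : nat) (beta : R) d
    (T : measurableType d) (P : probability T R)
    (g : 'I_N * 'I_N -> {RV P >-> R}) :
  SK_disorder g ->
  ('E_P[fun w => (SK_partition beta g w ^+ k)%R] =
  (\sum_(t : {ffun 'I_N -> config k})
    expR (beta ^+ 2 / (2 * N%:R) *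
      \sum_(ij in upper_pairs N) config_dot R (t ij.1) (t ij.2) ^+ 2))%:E)%E.
Proof.
move=> SKg; rewrite expectation.unlock.
under eq_integral do rewrite SK_partition_expr -sumEFin.
rewrite ge0_integral_sum//; last first.
  move=> t; apply/measurable_EFinP; apply: measurableT_comp => //.
  under eq_fun do rewrite -big_filter.
  by apply: measurable_sum => i; exact: measurable_funM.
rewrite -sumEFin; apply: eq_bigr => t _.
rewrite (integral_expR_disorder _ SKg); congr (expR _)%:E.
rewrite mulr_sumr; apply: eq_bigr => ij _.
rewrite !exprMn exprVn sqr_sqrtr ?ler0n// invfM; ring.
Qed.

Lemma config_dotC (R : realType) (n : nat) (s t : config n) :
  config_dot R s t = config_dot R t s.
Proof. by apply: eq_bigr => i _; rewrite mulrC. Qed.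

Theorem corollary1p2 (R : realType) (beta : R) (k : nat)
    (d : nat -> measure_display) (T : forall N : nat, measurableType (d N))
    (P : forall N : nat, probability (T N) R)
    (g : forall N : nat, 'I_N * 'I_N -> {RV (P N) >-> R}) :
  0 < beta -> (1 <= k)%N ->
  (forall N : nat, (2 <= N)%N -> SK_disorder (g N)) ->
  exists M : R,
    is_maximum (entropy_energy beta @` simplex R (config k)) M /\
    ((N%:R^-1)%:E * lne ('E_(P N)[fun w => (SK_partition beta (g N) w ^+ k)%R]))%E
      @[N --> \oo] --> M%:E.
Proof.
move=> _ _ SKg.
pose W (s t : config k) := beta ^+ 2 / 4 * config_dot R s t ^+ 2.
have entropyE p : entropy_energy beta p = mean_field_functional W p.
  rewrite /entropy_energy /mean_field_functional; congr (_ + _).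
  rewrite mulr_sumr; apply: eq_bigr => s _; rewrite mulr_sumr.
  by apply: eq_bigr => t _; rewrite mulrCA.
have S0 : (0 < #|{: config k}|)%N by apply/card_gt0P; exists [ffun=> true].
have [p Sp maxp] := mean_field_functional_max W S0.
exists (mean_field_functional W p); split.
  split; first by exists p.
  by move=> _ [q Sq <-]; rewrite entropyE; exact: maxp.
have symW s t : W s t = W t s by rewrite /W config_dotC.
have W0 s : 0 <= W s s by rewrite mulr_ge0 ?divr_ge0 ?sqr_ge0.
apply: (@cvg_trans _
  ((N%:R^-1 * ln (mean_field_partition W N))%:E @[N --> \oo])); last first.
  by apply: cvg_EFin; [exact: nearW|exact: mean_field_limit].
(* The disorder is specified only for [N >= 2], so the two sequences are compared eventually. *)
apply: near_eq_cvg; near=> N.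
have N2 : (2 <= N)%N by near: N; exact: nbhs_infty_ge.
rewrite (expectation_SK_partition_expr _ _ (SKg N N2)).
rewrite (_ : \sum_t _ = mean_field_partition W N).
  (* The moment is finite and positive, so the extended logarithm is the real one. *)
  by rewrite lne_EFin ?mean_field_partition_gt0// EFinM.
apply: eq_bigr => t _; congr expR; rewrite mulr_sumr [RHS]mulr_sumr.
apply: eq_bigr => ij _; rewrite /W; field.
by rewrite gt_eqF// ltr0n (leq_trans _ N2).
Unshelve. all: by end_near. Qed.
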